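(* Let $\alpha>0$, $0<q<\infty$, and let $\mu$ be a positive Borel measure on $\mathbb{C}$. If $\mu$ is an $(\infty,q)$ Fock-Carleson measure, then $\tilde{\mu}_t\in L^\infty(\mathbb{C},dA)$ for every $t>0$.
   Context: $F^\infty_\alpha$ is the space of entire functions $f$ with $\|f\|_{\infty,\alpha}=\sup_{z}|f(z)|e^{-\alpha|z|^2/2}<\infty$. $\mu$ is an $(\infty,q)$ Fock-Carleson measure if there is $C>0$ with $\left[\int_{\mathbb{C}}|f(z)e^{-\alpha|z|^2/2}|^q\,d\mu(z)\right]^{1/q}\le C\|f\|_{\infty,\alpha}$ for all $f\in F^\infty_\alpha$. For $t>0$, $\tilde{\mu}_t(z)=\frac{\alpha}{\pi}\int_{\mathbb{C}}e^{-\alpha t|z-w|^2/2}\,d\mu(w)$, and $dA$ is area measure. *)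

(* Defs.v *)
(* The complex plane is modelled in two
   (canonically identified) ways:
   - as the field R[i] (mathcomp-real-closed `complex`), for holomorphy;
   - as the product measurable space R * R (Borel sets of R^2), for measures;
   the identification is toC (x, y) = x + i y. *)
From HB Require Import structures.
From mathcomp Require Import all_boot all_order all_algebra.
From mathcomp Require Import all_classical all_reals all_analysis.
From mathcomp Require Import complex measurable_realfun.
Set Implicit Arguments.
Unset Strict Implicit.
Unset Printing Implicit Defensive.
Import Order.TTheory GRing.Theory Num.Theory.
Import numFieldNormedType.Exports.
Local Open Scope ring_scope.

(* C = R^2 as a measurable space: product of two copies of the Borel
   sigma-algebra of R (generated by intervals), i.e. the Borel sets of R^2 *)
Notation Cplane R := (measurableTypeR R * measurableTypeR R)%type.

Definition toC (R : realType) (p : Cplane R) : R[i] := (p.1 +i* p.2)%C.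

Definition cabs (R : realType) (z : R[i]) : R := Normc.normc z.

(* f is entire: complex differentiable at every point of C
   (derivative over the scalar field R[i]) *)
Definition entire (R : realType) (f : R[i] -> R[i]) : Prop :=
  forall z : R[i], derivable (f : R[i]^o -> R[i]^o) z 1.

Definition fock_weight (R : realType) (alpha : R) (f : R[i] -> R[i]) (z : R[i]) : R :=
  cabs (f z) * expR (- (alpha * cabs z ^+ 2) / 2).

Definition fock_inf_norm (R : realType) (alpha : R) (f : R[i] -> R[i]) : \bar R :=
  ereal_sup (range (fun z => (fock_weight alpha f z)%:E)).

Definition in_Fock_inf (R : realType) (alpha : R) (f : R[i] -> R[i]) : Prop :=
  entire f /\ (fock_inf_norm alpha f < +oo)%E.

Definition Fock_Carleson_inf (R : realType) (alpha q : R)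
    (mu : {measure set (Cplane R) -> \bar R}) : Prop :=
  exists C : R, 0 < C /\
    forall f : R[i] -> R[i], in_Fock_inf alpha f ->
      (Lnorm mu q%:E (fun p => (fock_weight alpha f (toC p))%:E)
        <= C%:E * fock_inf_norm alpha f)%E.

Definition mu_tilde (R : realType) (alpha t : R)
    (mu : {measure set (Cplane R) -> \bar R}) (z : Cplane R) : \bar R :=
  ((alpha / pi)%:E *
    \int[mu]_w (expR (- (alpha * t * cabs (toC z - toC w) ^+ 2) / 2))%:E)%E.

Definition areaA (R : realType) : {measure set (Cplane R) -> \bar R} :=
  (@lebesgue_measure R \x @lebesgue_measure R)%E.

Definition in_Linf_area (R : realType) (g : Cplane R -> \bar R) : Prop :=
  measurable_fun [set: Cplane R] g /\ (Lnorm (areaA R) +oo%E g < +oo)%E.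

(* Main.v *)
(* Testing the Carleson inequality on the normalized reproducing kernels
   f_a(z) = exp(alpha conj(a) z - alpha |a|^2 / 2), for which
   |f_a(z)| exp(-alpha |z|^2 / 2) = exp(-alpha |z - a|^2 / 2), bounds the
   Gaussian averages of mu of rate alpha q / 2 uniformly in the centre a. In one
   real variable, a Gaussian of any rate is dominated by a sum with geometric
   weights of integer translates of a Gaussian of any other rate; using this in
   x and then in y carries the uniform bound to the rate alpha t / 2. *)
Require Import Defs.
From HB Require Import structures.
From mathcomp Require Import all_boot all_order all_algebra.
From mathcomp Require Import all_classical all_reals all_analysis.
From mathcomp Require Import complex measurable_realfun.
From mathcomp Require Import ess_sup_inf ring lra.
Set Implicit Arguments.
Unset Strict Implicit.
Import Order.TTheory GRing.Theory Num.Theory.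
Import numFieldNormedType.Exports.
Local Open Scope ring_scope.

(** * The complex exponential and its second-order remainder near 0 *)

Definition cexp (R : realType) (z : R[i]) : R[i] :=
  ((expR (complex.Re z))%:C * (cos (complex.Im z) +i* sin (complex.Im z)))%C.

Lemma cexpD (R : realType) (z w : R[i]) : cexp (z + w) = cexp z * cexp w.
Proof.
case: z w => [a b] [c d]; rewrite /cexp /= expRD cosD sinD.
by apply/eqP; rewrite eq_complex /=; apply/andP; split; apply/eqP; ring.
Qed.

Lemma normc_cexp (R : realType) (z : R[i]) :
  Normc.normc (cexp z) = expR (complex.Re z).
Proof.
case: z => a b; rewrite /cexp /= !mul0r subr0 addr0 !exprMn -mulrDr cos2Dsin2.
by rewrite mulr1 sqrtr_sqr ger0_norm ?expR_ge0.
Qed.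

(** Both bounds come from [1 + u <= expR u]: with [u = x] it is the lower one; with [u = - x] it
    gives [expR x * (1 - x) <= 1], and [1 <= (1 + x + 2 x^2) (1 - x)] as long as [x <= 1 / 2]. *)
Lemma expR_taylor1 (R : realType) (x : R) : `|x| <= 1 / 2 ->
  0 <= expR x - 1 - x <= 2 * x ^+ 2.
Proof.
move=> hx.
have := expR_ge1Dx x; have := expR_ge1Dx (- x); have := expRxMexpNx_1 x.
have := expR_gt0 x; move: hx; rewrite ler_norml => /andP[h1 h2].
set e := expR x; set e' := expR (- x) => e0 ee' h3 h4.
apply/andP; split; first lra.
have h5 : e * (1 - x) <= 1 by rewrite -[leRHS]ee' ler_pM2l.
have : e * (1 - x) <= (1 + x + 2 * x ^+ 2) * (1 - x).
  apply: (le_trans h5).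
  have : 0 <= x ^+ 2 * (1 - 2 * x) by rewrite mulr_ge0 ?sqr_ge0//; lra.
  lra.
by rewrite ler_pM2r; lra.
Qed.

Lemma ler_norm_sin (R : realType) (x : R) : `|sin x| <= `|x|.
Proof.
wlog x0 : x / 0 <= x => [H|].
  have [/H//|/ltW x0] := leP 0 x.
  by rewrite -normrN -sinN -[leRHS]normrN H// oppr_ge0.
have [//|c _] := @MVT_segment R sin cos 0 x x0 (fun y _ => is_derive_sin y).
  by apply: continuous_subspaceT; exact: continuous_sin.
rewrite sin0 !subr0 => ->; rewrite normrM.
by rewrite ler_piMl// cos_max.
Qed.

(** Half-angle formula [1 - cos x = 2 sin^2 (x / 2)], combined with [|sin u| <= |u|]. *)
Lemma cos_taylor1 (R : realType) (x : R) : 0 <= 1 - cos x <= x ^+ 2 / 2.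
Proof.
rewrite subr_ge0 cos_le1 /=.
have -> : cos x = 1 - (sin (x / 2)) ^+ 2 *+ 2.
  rewrite {1}(_ : x = (x / 2) *+ 2); last by lra.
  by rewrite cos_mulr2n sin2cos2; lra.
have := ler_norm_sin (x / 2); rewrite -ler_sqr ?nnegrE// !real_normK ?num_real//.
by move=> h; nra.
Qed.

Lemma sin_taylor1 (R : realType) (x : R) : `|x| <= 1 -> `|sin x - x| <= x ^+ 2.
Proof.
wlog x0 : x / 0 <= x => [H|].
  have [/H//|/ltW x0] := leP 0 x.
  by have := H (- x); rewrite oppr_ge0 normrN sinN sqrrN -opprD normrN; apply.
(* The mean value theorem gives [sin x - x = x (cos c - 1)] with [0 <= c <= x]; the resulting cubic
   bound is relaxed to a quadratic one. *)
move=> x1; have [//|c cx] := @MVT_segment R sin cos 0 x x0 (fun y _ => is_derive_sin y).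
  by apply: continuous_subspaceT; exact: continuous_sin.
rewrite sin0 !subr0 => ->.
rewrite -{2}(mul1r x) -mulrBl normrM distrC (ger0_norm x0).
have /andP[h1 h2] := cos_taylor1 c.
rewrite ger0_norm//.
move: cx x1; rewrite in_itv /= (ger0_norm x0) => /andP[c0 cx] x1.
have : c ^+ 2 <= x ^+ 2 by rewrite ler_sqr ?nnegrE.
nra.
Qed.

(** Real and imaginary parts of the remainder are each at most twice [x ^+ 2 + y ^+ 2]; the constant
    6 is generous. *)
Lemma cexp_taylor1 (R : realType) (z : R[i]) : Normc.normc z <= 1 / 2 ->
  Normc.normc (cexp z - 1 - z) <= 6 * Normc.normc z ^+ 2.
Proof.
case: z => x y; rewrite /cexp /= !mul0r subr0 addr0.
have n0 : 0 <= x ^+ 2 + y ^+ 2 by rewrite addr_ge0 ?sqr_ge0.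
rewrite sqr_sqrtr// => h.
have h' : x ^+ 2 + y ^+ 2 <= 1 / 4.
  by rewrite -(sqr_sqrtr n0); have := sqrtr_ge0 (x ^+ 2 + y ^+ 2); nra.
have hx : `|x| <= 1 / 2.
  by rewrite -ler_sqr ?nnegrE//; rewrite real_normK ?num_real//; nra.
have hy : `|y| <= 1 / 2.
  by rewrite -ler_sqr ?nnegrE//; rewrite real_normK ?num_real//; nra.
have /andP[e1 e2] := expR_taylor1 hx.
have /andP[c1 c2] := cos_taylor1 y.
have s1 : `|sin y - y| <= y ^+ 2 by apply: sin_taylor1; lra.
have s2 := ler_norm_sin y.
set e := expR x in e1 e2 *; set s := sin y in s1 s2 *; set c := cos y in c1 c2 *.
have nx2 : `|x| ^+ 2 = x ^+ 2 by rewrite real_normK ?num_real.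
have ny2 : `|y| ^+ 2 = y ^+ 2 by rewrite real_normK ?num_real.
have re : `|e * c - 1 - x| <= 2 * x ^+ 2 + y ^+ 2.
  (* This splitting isolates the exponential remainder and the cosine remainder; the latter has a
     factor [1 + x] of size at most 2. *)
  have -> : e * c - 1 - x = (e - 1 - x) * c - (1 + x) * (1 - c) by ring.
  have a1 := cos_max y; rewrite -/c in a1.
  apply: (le_trans (ler_normB _ _)); rewrite !normrM lerD//.
    by rewrite (ger0_norm e1) (le_trans _ e2)// ler_piMr.
  rewrite (ger0_norm c1) (@le_trans _ _ (2 * (1 - c)))//; last lra.
  by rewrite ler_wpM2r// (le_trans (ler_normD _ _))// normr1; lra.
have im : `|e * s - 0 - y| <= 2 * (x ^+ 2 + y ^+ 2).
  have -> : e * s - 0 - y = (e - 1) * s + (s - y) by ring.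
  apply: (le_trans (ler_normD _ _)).
  have : `|e - 1| <= 2 * `|x|.
    have -> : e - 1 = (e - 1 - x) + x by ring.
    by apply: (le_trans (ler_normD _ _)); rewrite (ger0_norm e1); have := normr_ge0 x; nra.
  rewrite normrM; have := normr_ge0 x; have := normr_ge0 y.
  (* The square supplies [2 |x| |y| <= x^2 + y^2], which absorbs the cross term [(e - 1) * s]. *)
  have := normr_ge0 s; have := normr_ge0 (e - 1); have := sqr_ge0 (`|x| - `|y|).
  move: s2 s1 nx2 ny2.
  set a := `|x|; set b := `|y|; set k := `|s|; set l := `|e - 1|; set m := `|s - y|.
  move=> kb my ax yb sq l0 k0 b0 a0 la.
  have : l * k <= 2 * a * b by apply: ler_pM.
  nra.
have -> : 6 * (x ^+ 2 + y ^+ 2) = Num.sqrt ((6 * (x ^+ 2 + y ^+ 2)) ^+ 2).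
  by rewrite sqrtr_sqr ger0_norm// mulr_ge0.
rewrite ler_wsqrtr// -(real_normK (num_real (_ * c - _ - x))) -(real_normK (num_real (_ * s - _ - y))).
have := normr_ge0 (e * c - 1 - x); have := normr_ge0 (e * s - 0 - y).
rewrite !(addrN, mul0r, addr0, subr0) in im *.
move: re im; set A := `|_|; set B := `|_| => re im B0 A0.
have : A <= 2 * (x ^+ 2 + y ^+ 2) by have := sqr_ge0 y; lra.
move: im n0; set S := x ^+ 2 + y ^+ 2; nra.
Qed.

(** * Holomorphy of exponentials of affine functions *)

Lemma derivable_quadratic_remainder (K : numFieldType) (f : K^o -> K^o)
    (z l M r : K) : 0 <= M -> 0 < r ->
  (forall h, `|h| <= r -> `|f (h + z) - f z - l * h| <= M * `|h| ^+ 2) ->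
  derivable f z 1.
Proof.
move=> M0 r0 fM; apply: (@cvgP _ _ (l : K^o)).
apply/cvgrPdist_le => /= e e0.
have M1 : 0 < M + 1 by rewrite ltr_wpDl.
near=> h.
have h0 : h != 0 by near: h; exact: nbhs_dnbhs_neq.
(* The quotient is within [M * |h|] of [l]; dividing by [M + 1] also covers [M = 0]. *)
have hM : `|h| <= e / (M + 1).
  by near: h; apply: (@dnbhs0_le _ K^o); rewrite divr_gt0.
have hr : `|h| <= r by near: h; exact: (@dnbhs0_le _ K^o).
have -> : l - h^-1 *: (f (h *: (1 : K^o) + z) - f z)
        = - (h^-1 * (f (h + z) - f z - l * h)).
  rewrite (_ : h *: (1 : K^o) = h); last exact: mulr1.
  rewrite /GRing.scale /=; set a := f _; field. exact: h0.
rewrite normrN normrM normfV mulrC ler_pdivrMr ?normr_gt0//.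
apply: (le_trans (fM _ hr)); rewrite expr2 mulrA ler_wpM2r//.
apply: (@le_trans _ _ ((M + 1) * (e / (M + 1)))).
  by apply: ler_pM => //; rewrite lerDl.
by rewrite mulrC divfK// gt_eqF.
Unshelve. all: by end_near. Qed.

Lemma normr_complexE (R : realType) (z : R[i]) : `|z| = ((Normc.normc z)%:C)%C.
Proof. by case: z => x y; rewrite normc_def. Qed.

(** By the addition formula the remainder at [z] is [f z * (cexp (c * h) - 1 - c * h)], quadratic in
    [h]. The radius keeps [|c * h| <= 1 / 2] and stays meaningful for [c = 0]. *)
Lemma entire_cexp_affine (R : realType) (c d : R[i]) :
  entire (fun z => cexp (c * z + d)).
Proof.
move=> z; set f := (fun z => _).
have c1 : 0 < `|c| + 1 by rewrite ltr_wpDl.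
apply: (@derivable_quadratic_remainder _ _ _ (f z * c)
  (`|f z| * 6 * `|c| ^+ 2) (1 / (2 * (`|c| + 1)))).
- by rewrite !mulr_ge0// exprn_ge0.
- by rewrite divr_gt0// mulr_gt0.
move=> h hr.
have ch : `|c * h| <= 1 / 2.
  rewrite normrM (@le_trans _ _ ((`|c| + 1) * (1 / (2 * (`|c| + 1)))))//.
    by apply: ler_pM => //; rewrite lerDl.
  by rewrite invfM mul1r mulrCA mulfV ?mulr1 ?mul1r// gt_eqF.
have -> : f (h + z) - f z - f z * c * h = f z * (cexp (c * h) - 1 - c * h).
  have -> : f (h + z) = f z * cexp (c * h).
    by rewrite /f -cexpD; congr cexp; ring.
  by ring.
have -> : `|f z| * 6 * `|c| ^+ 2 * `|h| ^+ 2 = `|f z| * (6 * `|c * h| ^+ 2).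
  by rewrite [`|c * h|]normrM; ring.
rewrite normrM ler_wpM2l//.
move: ch; rewrite !normr_complexE (_ : 1 / 2 = (1 / 2)%:C%C); last first.
  by rewrite rmorphM fmorphV rmorph1 rmorph_nat.
rewrite lecR => /cexp_taylor1.
by rewrite -lecR rmorphM rmorphXn rmorph_nat.
Qed.

(** * Testing the Carleson inequality on normalized reproducing kernels *)

(** The modulus of [cexp] sees only the real part of the exponent, where adding the Fock weight
    completes the square around the centre [a + i b]. *)
Lemma fock_weight_gauss (R : realType) (alpha a b x y : R) :
  fock_weight alpha (fun z => cexp (((alpha * a +i* - (alpha * b)) * z
    + (- (alpha * (a ^+ 2 + b ^+ 2) / 2))%:C)%C)) (x +i* y)%C
  = expR (- (alpha / 2) * ((x - a) ^+ 2 + (y - b) ^+ 2)).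
Proof.
rewrite /fock_weight /cabs normc_cexp /= sqr_sqrtr ?addr_ge0 ?sqr_ge0//.
by rewrite -expRD; congr expR; field.
Qed.

Lemma Fock_Carleson_gauss_bounded (R : realType) (alpha q : R)
    (mu : {measure set (Cplane R) -> \bar R}) : 0 < alpha -> 0 < q ->
  Fock_Carleson_inf alpha q mu ->
  exists M : R, forall a b : R,
    (\int[mu]_w (expR (- (alpha * q / 2) * ((w.1 - a) ^+ 2 + (w.2 - b) ^+ 2)))%:E
      <= M%:E)%E.
Proof.
move=> alpha0 q0 [C [C0 FC]]; exists (C `^ q) => a b.
set f := (fun z => cexp (((alpha * a +i* - (alpha * b)) * z
    + (- (alpha * (a ^+ 2 + b ^+ 2) / 2))%:C)%C)).
have nf : (fock_inf_norm alpha f <= 1)%E.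
  apply: ge_ereal_sup => _ [[x y] _ <-].
  rewrite fock_weight_gauss lee_fin expR_le1 mulNr oppr_le0.
  by rewrite mulr_ge0 ?divr_ge0 ?addr_ge0 ?sqr_ge0 ?ltW.
have {FC} := FC f (conj (@entire_cexp_affine R _ _) (le_lt_trans nf (ltry _))).
move=> /le_trans /(_ (lee_wpmul2l _ nf)); rewrite lee_fin mule1 => /(_ (ltW C0)) fC.
(* Taking the power [q] removes the outer root of the norm and turns the Gaussian of rate
   [alpha / 2] into one of rate [alpha * q / 2]. *)
have : (Lnorm mu q%:E (fun p => (fock_weight alpha f (toC p))%:E) `^ q <= C%:E `^ q)%E.
  by apply: gt0_ler_poweR => //; rewrite ?ltW// in_itv /= leey andbT ?Lnorm_ge0// lee_fin ltW.
rewrite poweR_Lnorm ?gt_eqF//; apply: le_trans.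
rewrite le_eqVlt; apply/orP; left; apply/eqP; apply: eq_integral => -[x y] _.
rewrite /toC fock_weight_gauss abse_EFin /= ger0_norm ?expR_ge0//.
by rewrite -expRM; congr (expR _)%:E => /=; field.
Qed.

(** * Changing the rate of a Gaussian in one real variable *)

(** Take [n] the integer part of [|x|]. Then [x^2 >= n^2 >= n] yields the geometric weight, and
    [(|x| - n)^2 <= 1] lets [expR s] compensate the translated Gaussian. The two translates cover
    both signs of [x]. *)
Lemma gauss_le_translates (R : realType) (s s' x : R) : 0 < s -> 0 < s' ->
  exists n : nat, expR (- s' * x ^+ 2) <= expR s * expR (- s') ^+ n *
    (expR (- s * (x - n%:R) ^+ 2) + expR (- s * (x + n%:R) ^+ 2)).
Proof.
move=> s0 s'0; exists (Num.truncn `|x|).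
have /andP[] := truncn_itv (normr_ge0 x); set n := Num.truncn _.
rewrite -natr1 => nx xn.
rewrite (@le_trans _ _ (expR (s - s' * n%:R - s * (`|x| - n%:R) ^+ 2)))//.
  rewrite ler_expR.
  have h1 : n%:R <= x ^+ 2.
    rewrite -(real_normK (num_real x)) (@le_trans _ _ (n%:R ^+ 2))//.
      by rewrite -natrX ler_nat; case: n {nx xn} => // n; rewrite leq_pmulr.
    by rewrite ler_sqr ?nnegrE.
  have h2 : (`|x| - n%:R) ^+ 2 <= 1.
    by rewrite -[leRHS](expr1n _ 2) ler_sqr ?nnegrE ?subr_ge0//; lra.
  have : s' * n%:R <= s' * x ^+ 2 by rewrite ler_pM2l.
  have : s * (`|x| - n%:R) ^+ 2 <= s * 1 by rewrite ler_pM2l.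
  lra.
rewrite !expRD -[- (s' * _)]mulNr expRM_natr -[- (s * _)]mulNr.
rewrite ler_wpM2l ?mulr_ge0 ?exprn_ge0 ?expR_ge0//.
have [x0|x0] := leP 0 x; first by rewrite ger0_norm// lerDl expR_ge0.
by rewrite ltr0_norm// -opprD sqrrN lerDr expR_ge0.
Qed.

Lemma nneseries_geometric_le (R : realType) (K z : R) : 0 <= K -> 0 <= z < 1 ->
  (\sum_(n <oo) (K * z ^+ n)%:E <= (K / (1 - z))%:E)%E.
Proof.
move=> K0 /andP[z0 z1]; apply: lime_le.
  by apply: is_cvg_nneseries => n _ _; rewrite lee_fin mulr_ge0// exprn_ge0.
apply: nearW => n; rewrite sumEFin lee_fin ler_pdivlMr ?subr_gt0//.
rewrite -mulr_sumr -mulrA big_mkord -[1 - z]opprB mulrN mulrC.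
have := subrX1 z n; rewrite [in RHS]mulrC mulrC => H.
have := exprn_ge0 n z0; nra.
Qed.

(** The new Gaussian is dominated by a weighted series of translates of the old one; each translate
    integrates to at most [M] because the hypothesis is uniform in the centre. The factor [h i]
    holds the Gaussian in the other coordinate, with centre [i], so that uniformity in both centres
    survives. *)
Lemma gauss_rate_change d (T : measurableType d) (R : realType)
    (mu : {measure set T -> \bar R}) (I : Type) (X : T -> R) (h : I -> T -> R)
    (s s' M : R) :
  0 < s -> 0 < s' -> measurable_fun setT X -> (forall i, measurable_fun setT (h i)) ->
  (forall i w, 0 <= h i w) ->
  (forall i a, (\int[mu]_w (expR (- s * (X w - a) ^+ 2) * h i w)%:E <= M%:E)%E) ->
  exists M' : R, forall i a,
    (\int[mu]_w (expR (- s' * (X w - a) ^+ 2) * h i w)%:E <= M'%:E)%E.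
Proof.
move=> s0 s'0 mX mh h0 XM.
(* Two translates per term, times the sum of the geometric weights. *)
exists (2 * expR s * M / (1 - expR (- s'))) => i a.
move: (h i) (mh i) (h0 i) (XM i) => {mh h0 XM} {}h mh h0 XM.
pose g a w : R := expR (- s * (X w - a) ^+ 2) * h w.
have g0 a' w : 0 <= g a' w by rewrite mulr_ge0// expR_ge0.
have mg r a' : measurable_fun setT
    (fun w => (expR (- r * (X w - a') ^+ 2) * h w)%:E).
  apply/measurable_EFinP; apply: measurable_funM => //.
  apply: measurableT_comp => //; apply: measurable_funM => //.
  by apply: measurable_funX; exact: measurable_funB.
have M0 : 0 <= M.
  rewrite -lee_fin; apply: le_trans (XM 0); apply: integral_ge0 => w _.
  by rewrite lee_fin g0.
have z01 : 0 <= expR (- s') < 1 by rewrite expR_ge0 expR_lt1 oppr_lt0.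
pose c n := expR s * expR (- s') ^+ n.
have c0 n : 0 <= c n by rewrite mulr_ge0 ?exprn_ge0 ?expR_ge0.
pose f n w := ((c n)%:E * ((g (a + n%:R) w)%:E + (g (a - n%:R) w)%:E))%E.
have f0 n w : (0 <= f n w)%E by rewrite mule_ge0 ?adde_ge0 ?lee_fin.
have mf n : measurable_fun setT (f n).
  apply: measurable_funeM; apply: emeasurable_funD; exact: mg.
apply: (@le_trans _ _ (\int[mu]_w \sum_(n <oo) f n w)%E).
  apply: ge0_le_integral => //.
  - by move=> w _; rewrite lee_fin mulr_ge0// expR_ge0.
  - exact: (@ge0_emeasurable_sum _ _ _ setT f xpredT).
  move=> w _; have [n hn] := @gauss_le_translates R s s' (X w - a) s0 s'0.
  apply: (@le_trans _ _ (f n w)).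
    rewrite /f -EFinD -EFinM lee_fin /g -mulrDl mulrA ler_wpM2r//.
    have -> : X w - (a + n%:R) = X w - a - n%:R by rewrite opprD addrA.
    by have -> : X w - (a - n%:R) = X w - a + n%:R by rewrite opprB addrCA addrC.
  (* The partial sum of the first [n.+1] terms is the shortest one containing the term of index
     [n]. *)
  apply: le_trans (@nneseries_lim_ge _ (fun n => f n w) xpredT 0%N n.+1 _) => //.
  by rewrite big_nat_recr//= leeDr// sume_ge0.
rewrite integral_nneseries//.
apply: (@le_trans _ _ (\sum_(n <oo) (2 * expR s * M * expR (- s') ^+ n)%:E)%E).
  apply: lee_nneseries => [n _ _|n _]; first exact: integral_ge0.
  rewrite ge0_integralZl_EFin//; last 2 first.
  - by move=> w _; rewrite adde_ge0 ?lee_fin.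
  - by apply: emeasurable_funD; exact: mg.
  rewrite ge0_integralD//; last 4 first.
  - by move=> w _; rewrite lee_fin.
  - exact: mg.
  - by move=> w _; rewrite lee_fin.
  - exact: mg.
  apply: (@le_trans _ _ ((c n)%:E * (M%:E + M%:E))%E).
    apply: lee_wpmul2l; first by rewrite lee_fin.
    apply: leeD; exact: XM.
  rewrite -EFinD -EFinM lee_fin le_eqVlt; apply/orP; left; apply/eqP.
  rewrite /c; ring.
by apply: nneseries_geometric_le => //; rewrite !mulr_ge0 ?expR_ge0.
Qed.

(** * Sigma-finiteness and measurability of parametric integrals *)

(** The superlevel sets of [g] at heights [1 / (n + 1)] exhaust the space since [g > 0], and
    Markov's inequality makes each of finite measure. *)
Lemma integrable_pos_sigma_finite d (T : measurableType d) (R : realType)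
    (mu : {measure set T -> \bar R}) (g : T -> R) :
  measurable_fun setT g -> (forall w, 0 < g w) ->
  (\int[mu]_w (g w)%:E < +oo)%E -> sigma_finite setT mu.
Proof.
move=> mg g0 gfin.
have mgE : measurable_fun setT (EFin \o g) by exact/measurable_EFinP.
exists (fun n => [set w : T | ((n.+1%:R^-1)%:E <= (EFin \o g) w)%E]%classic).
  apply/esym; rewrite -subTset => w _.
  exists (Num.truncn (g w)^-1) => //=; rewrite lee_fin.
  rewrite invf_ple ?posrE//.
  have gi : 0 <= (g w)^-1 by rewrite invr_ge0 ltW.
  by have /andP[_ /ltW] := truncn_itv gi.
move=> n; set F := [set w | _]%classic.
have mF : measurable F by rewrite -[F]setTI; exact: emeasurable_fun_c_infty.
split=> //.
have gn : (\int[mu]_w `|(g w)%:E| < +oo)%E.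
  rewrite (eq_integral (fun w => (g w)%:E))// => w _.
  by rewrite abse_EFin gtr0_norm.
have n0 : 0 < n.+1%:R^-1 :> R by rewrite invr_gt0.
have := le_lt_trans (le_integral_abse mu measurableT mgE n0) gn.
rewrite setTI (_ : [set x | _]%classic = F); last first.
  by apply/seteqP; split=> w; rewrite /F /= gtr0_norm.
by case: (mu F) => [r||] //; rewrite ?ltry ?ltNyr// gt0_muley ?lte_fin.
Qed.

(** Part of Tonelli's theorem; [nu] is [mu] itself bundled with the proof of its
    sigma-finiteness. *)
Lemma measurable_fun_integral_param d1 d2 (T1 : measurableType d1)
    (T2 : measurableType d2) (R : realType)
    (mu : {measure set T2 -> \bar R}) (k : T1 * T2 -> \bar R) :
  sigma_finite setT mu -> measurable_fun setT k -> (forall x, 0 <= k x)%E ->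
  measurable_fun setT (fun x => \int[mu]_y k (x, y))%E.
Proof.
move=> mu_sfin mk k0.
pose nu : {sigma_finite_measure set T2 -> \bar R} :=
  HB.pack (Measure.sort mu) (isSFinite.Build _ _ _ _
    (sfinite_measure_sigma_finite mu_sfin)) (isSigmaFinite.Build _ _ _ _ mu_sfin).
exact: (@measurable_fun_fubini_tonelli_F _ _ _ _ _ nu k).
Qed.

Theorem theorem2p7 (R : realType) (alpha q : R)
    (mu : {measure set (Cplane R) -> \bar R}) :
  0 < alpha -> 0 < q ->
  Fock_Carleson_inf alpha q mu ->
  forall t : R, 0 < t -> in_Linf_area (mu_tilde alpha t mu).
Proof.
move=> alpha0 q0 FC t t0.
have [M qM] := Fock_Carleson_gauss_bounded alpha0 q0 FC.
set s := alpha * q / 2 in qM; pose s' := alpha * t / 2.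
have s0 : 0 < s by rewrite divr_gt0 ?mulr_gt0.
have s'0 : 0 < s' by rewrite divr_gt0 ?mulr_gt0.
(* The Gaussian centred at 0 is positive and [mu]-integrable; sigma-finiteness will give
   measurability of [mu_tilde]. *)
have mu_sfin : sigma_finite setT mu.
  apply: (@integrable_pos_sigma_finite _ _ _ mu
    (fun w => expR (- s * ((w.1 - 0) ^+ 2 + (w.2 - 0) ^+ 2)))).
  - apply: measurableT_comp => //; apply: measurable_funM => //.
    by apply: measurable_funD; apply: measurable_funX; apply: measurable_funB.
  - by move=> w; exact: expR_gt0.
  - exact: le_lt_trans (qM 0 0) (ltry _).
have tildeE z : mu_tilde alpha t mu z = ((alpha / pi)%:E * \int[mu]_w
    (expR (- s' * ((w.1 - z.1) ^+ 2 + (w.2 - z.2) ^+ 2)))%:E)%E.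
  congr (_ * _)%E; apply: eq_integral => w _; congr (expR _)%:E.
  by rewrite /cabs /toC /= sqr_sqrtr ?addr_ge0 ?sqr_ge0// /s'; field.
have mk (r a : R) (p : Cplane R -> R) : measurable_fun setT p ->
    measurable_fun setT (fun w => expR (- r * (p w - a) ^+ 2)).
  move=> mp; apply: measurableT_comp => //; apply: measurable_funM => //.
  by apply: measurable_funX; exact: measurable_funB.
have m1 : measurable_fun setT (fst : Cplane R -> R) by exact: measurable_fst.
have m2 : measurable_fun setT (snd : Cplane R -> R) by exact: measurable_snd.
have [M' tM] : exists M' : R, forall a b : R, (\int[mu]_w
    (expR (- s' * ((w.1 - a) ^+ 2 + (w.2 - b) ^+ 2)))%:E <= M'%:E)%E.
  (* First pass: the rate in x goes from [s] to [s'], the y factor keeping rate [s]. *)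
  have [M1 M1P] : exists M1 : R, forall b a : R, (\int[mu]_w
      (expR (- s' * (w.1 - a) ^+ 2) * expR (- s * (w.2 - b) ^+ 2))%:E <= M1%:E)%E.
    apply: (gauss_rate_change s0 s'0 m1 (fun b => mk s b snd m2)).
      by move=> *; exact: expR_ge0.
    move=> b a.
    by under eq_integral => v _ do rewrite -expRD -mulrDr; exact: qM.
  (* Second pass: the rate in y changes, the x factor already having rate [s']. *)
  have [M2 M2P] : exists M2 : R, forall a b : R, (\int[mu]_w
      (expR (- s' * (w.2 - b) ^+ 2) * expR (- s' * (w.1 - a) ^+ 2))%:E <= M2%:E)%E.
    apply: (gauss_rate_change s0 s'0 m2 (fun a => mk s' a fst m1)).
      by move=> *; exact: expR_ge0.
    move=> a b.
    by under eq_integral => v _ do rewrite mulrC; exact: M1P.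
  exists M2 => a b.
  by under eq_integral => v _ do rewrite addrC mulrDr expRD; exact: M2P.
split.
  have mI : measurable_fun setT (fun z : Cplane R => \int[mu]_w
      (expR (- s' * ((w.1 - z.1) ^+ 2 + (w.2 - z.2) ^+ 2)))%:E)%E.
    apply: (@measurable_fun_integral_param _ _ _ _ _ mu (fun zw : Cplane R * Cplane R =>
      (expR (- s' * ((zw.2.1 - zw.1.1) ^+ 2 + (zw.2.2 - zw.1.2) ^+ 2)))%:E)) => //.
    apply/measurable_EFinP; apply: measurableT_comp => //; apply: measurable_funM => //.
    by apply: measurable_funD; apply: measurable_funX; apply: measurable_funB;
      apply: measurableT_comp.
  rewrite (funext tildeE).
  exact: measurable_funeM.
rewrite unlock /Lnorm; case: ifPn => // _.
(* The bound holds at every point, hence almost everywhere, and so controls the essential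
   supremum. *)
apply: (@le_lt_trans _ _ (alpha / pi * M')%:E); last exact: ltry.
apply/ess_supP; apply: nearW => z /=.
have ap0 : (0 <= (alpha / pi)%:E)%E by rewrite lee_fin divr_ge0 ?pi_ge0// ltW.
rewrite tildeE gee0_abs; last first.
  apply: mule_ge0 => //.
  by apply: integral_ge0 => w _; rewrite lee_fin expR_ge0.
by rewrite [leRHS]EFinM; apply: lee_wpmul2l; last exact: tM.
Qed.
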